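(* Let $k$ be an algebraically closed field of characteristic zero and let $L\in k(t)\langle D_t\rangle$ be nonzero. Then there exists $f\in k(t,x)\setminus D_x(k(t,x))$ such that $L(f)=D_x(g)$ for some $g\in k(t,x)$ if and only if the equation $L(y)=0$ has a nonzero solution $y$ in the algebraic closure $\overline{k(t)}$ of $k(t)$. Moreover, if $L$ is the minimal telescoper of some $f\in k(t,x)$, then all solutions of $L(y)=0$ are algebraic over $k(t)$, i.e. the $k$-vector space of solutions of $L(y)=0$ in $\overline{k(t)}$ has dimension equal to the order of $L$.
   Context: $D_t,D_x$ are the partial derivations on $k(t,x)$ (and $D_t$ extends uniquely to a derivation of $\overline{k(t)}$). $k(t)\langle D_t\rangle$ is the ring of linear differential operators $\sum_\ell e_\ell D_t^\ell$, $e_\ell\in k(t)$. A telescoper for $f\in k(t,x)$ is a nonzero $L\in k(t)\langle D_t\rangle$ with $L(f)=D_x(g)$ for some $g\in k(t,x)$; the telescopers for $f$ together with $0$ form a left ideal of $k(t)\langle D_t\rangle$, and the minimal telescoper of $f$ is the monic generator (of minimal order) of this left ideal. *)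

(* Defs.v *)
From HB Require Import structures.
From mathcomp Require Import all_boot all_order all_algebra ring.

Set Implicit Arguments.
Unset Strict Implicit.
Unset Printing Implicit Defensive.

Import GRing.Theory.
Local Open Scope ring_scope.
Local Open Scope quotient_scope.

Definition is_derivation (R : nzRingType) (D : R -> R) : Prop :=
  (forall a b, D (a + b) = D a + D b) /\
  (forall a b, D (a * b) = D a * b + a * D b).

(* Quotient rule applied to the chosen representative of a fraction; when d is
   a derivation the choice does not matter, see frac_derE. *)
Definition frac_der (R : idomainType) (d : R -> R) (u : {fraction R}) :
    {fraction R} :=
  let a := \n_(repr u) in let b := \d_(repr u) in
  tofrac (d a * b - a * d b) / tofrac b ^+ 2.

Notation ratfun F := ({fraction {poly F}}).

(* k(t,x) is represented as k(t)(x). *)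
Notation biratfun k := (ratfun (ratfun k)).

Definition ratC (F : fieldType) (a : F) : ratfun F := tofrac a%:P.

Lemma ratC_is_zmod_morphism (F : fieldType) : zmod_morphism (@ratC F).
Proof. by move=> a b; rewrite /ratC polyCB tofracB. Qed.

Lemma ratC_is_monoid_morphism (F : fieldType) : monoid_morphism (@ratC F).
Proof.
by split=> [|a b]; rewrite /ratC ?polyC1 ?tofrac1 ?polyCM ?tofracM.
Qed.

HB.instance Definition _ (F : fieldType) :=
  GRing.isZmodMorphism.Build F (ratfun F) (@ratC F) (@ratC_is_zmod_morphism F).
HB.instance Definition _ (F : fieldType) :=
  GRing.isMonoidMorphism.Build F (ratfun F) (@ratC F)
    (@ratC_is_monoid_morphism F).

Definition ratX (F : fieldType) : ratfun F := tofrac 'X.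

Definition Dt0 (k : fieldType) : ratfun k -> ratfun k :=
  frac_der (@deriv k).

Definition Dt (k : fieldType) : biratfun k -> biratfun k :=
  frac_der (map_poly (@Dt0 k)).

Definition Dx (k : fieldType) : biratfun k -> biratfun k :=
  frac_der (@deriv (ratfun k)).

(* The operator \sum_l e_l D^l of K<D> is encoded by the polynomial
   \sum_l e_l 'X^l, so its order is (size L).-1.  The product of K<D> is not
   the product of {poly K}: it is determined by D e = e D + D(e), whence
   D (\sum_l b_l D^l) = \sum_l (b_l D^(l+1) + D(b_l) D^l). *)
Definition diffop_mul (K : fieldType) (D : K -> K) (A B : {poly K}) :
    {poly K} :=
  \sum_(i < size A)
     A`_i *: iter i (fun M : {poly K} => M * 'X + map_poly D M) B.

(* Action of an operator over K on an extension F of K (along iota) endowed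
   with the derivation D. *)
Definition diffop_act (K F : fieldType) (iota : K -> F) (D : F -> F)
    (L : {poly K}) (y : F) : F :=
  \sum_(i < size L) iota L`_i * iter i D y.

Definition Dx_exact (k : fieldType) (f : biratfun k) : Prop :=
  exists g : biratfun k, f = Dx g.

Definition is_telescoper (k : fieldType) (f : biratfun k)
    (L : {poly ratfun k}) : Prop :=
  L != 0 /\ Dx_exact (diffop_act (@ratC (ratfun k)) (@Dt k) L f).

Definition is_minimal_telescoper (k : fieldType) (f : biratfun k)
    (L : {poly ratfun k}) : Prop :=
  L \is monic /\
  forall M : {poly ratfun k},
    (M = 0 \/ is_telescoper f M) <->
    (exists A : {poly ratfun k}, M = diffop_mul (@Dt0 k) A L).

Definition is_algebraic_closure (K : fieldType) (Kbar : closedFieldType)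
    (iota : {rmorphism K -> Kbar}) : Prop :=
  forall u : Kbar, algebraicOver iota u.

(* The subset S of F is a vector space of finite dimension n over k, where k
   acts on F through c. *)
Definition has_dimension (k F : fieldType) (c : k -> F) (S : F -> Prop)
    (n : nat) : Prop :=
  exists b : 'I_n -> F,
    (forall a : 'I_n -> k,
        \sum_(i < n) c (a i) * b i = 0 -> forall i, a i = 0) /\
    (forall y : F,
        S y <-> exists a : 'I_n -> k, y = \sum_(i < n) c (a i) * b i).

Lemma derivation01 (R : nzRingType) (D : R -> R) :
  is_derivation D -> D 0 = 0 /\ D 1 = 0.
Proof.
case=> DD DM; split; first by apply: (addrI (D 0)); rewrite -DD !addr0.
by apply: (addrI (D 1)); rewrite addr0 -[RHS](congr1 D (mulr1 1)) DM mulr1 mul1r.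
Qed.

Lemma quotient_ruleD (F : fieldType) (a b c d a' b' c' d' : F) :
  b != 0 -> d != 0 ->
  ((a' * d + a * d' + (c' * b + c * b')) * (b * d) -
     (a * d + c * b) * (b' * d + b * d')) / (b * d) ^+ 2 =
  (a' * b - a * b') / b ^+ 2 + (c' * d - c * d') / d ^+ 2.
Proof. by move=> b0 d0; field; rewrite b0 d0. Qed.

Lemma quotient_ruleM (F : fieldType) (a b c d a' b' c' d' : F) :
  b != 0 -> d != 0 ->
  ((a' * c + a * c') * (b * d) - a * c * (b' * d + b * d')) / (b * d) ^+ 2 =
  (a' * b - a * b') / b ^+ 2 * (c / d) + a / b * ((c' * d - c * d') / d ^+ 2).
Proof. by move=> b0 d0; field; rewrite b0 d0. Qed.

Section FractionDerivation.

Variables (R : idomainType) (d : R -> R).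
Hypothesis dP : is_derivation d.

Lemma fracE (u : {fraction R}) : u = tofrac \n_(repr u) / tofrac \d_(repr u).
Proof.
rewrite -[LHS]reprK -[in LHS](Ratio_numden (repr u)).
move: (denom_ratioP (repr u)); move: (\n__) (\d__) => a b b0.
have fb0 : tofrac b != 0 by rewrite tofrac_eq0.
apply: (mulIf fb0); rewrite mulfVK //; unlock FracField.tofrac.
rewrite -[LHS]FracField.pi_mul /FracField.mulf.
apply/eqmodP; rewrite /= FracField.equivfE !numden_Ratio ?mulf_neq0 ?oner_eq0 //.
by rewrite !mulr1 mulrC.
Qed.

Lemma frac_derE (a b : R) : b != 0 ->
  frac_der d (tofrac a / tofrac b) =
  tofrac (d a * b - a * d b) / tofrac b ^+ 2.
Proof.
case: dP => _ dM b0; rewrite /frac_der.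
set u := tofrac a / tofrac b; move: (fracE u) (denom_ratioP (repr u)).
move: (\n__) (\d__) => a' b'; rewrite {}/u => e b'0.
have e1 : a * b' = a' * b.
  apply/eqP; rewrite -tofrac_eq !tofracM -eqr_div ?tofrac_eq0 //.
  by rewrite e.
apply/eqP; rewrite eqr_div ?expf_neq0 ?tofrac_eq0 // -!tofracXn -!tofracM.
rewrite tofrac_eq; apply/eqP.
have e2 : d a * b' + a * d b' = d a' * b + a' * d b by rewrite -!dM e1.
apply/eqP; rewrite eq_sym -subr_eq0.
have -> : (d a * b - a * d b) * b' ^+ 2 - (d a' * b' - a' * d b') * b ^+ 2 =
    b * b' * ((d a * b' + a * d b') - (d a' * b + a' * d b)) -
    (d b * b' + d b' * b) * (a * b' - a' * b) by ring.
by rewrite e1 e2 !subrr !mulr0 subrr.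
Qed.

Lemma frac_der_derivation : is_derivation (frac_der d).
Proof.
case: dP => dD dM; split=> u v; rewrite (fracE u) (fracE v);
  move: (denom_ratioP (repr u)) (denom_ratioP (repr v));
  move: (\n__) (\d__) (\n__) (\d__) => a b a' b' b0 b'0;
  have fb0 : tofrac b != 0 by [rewrite tofrac_eq0];
  have fb'0 : tofrac b' != 0 by [rewrite tofrac_eq0].
  rewrite addf_div // -!tofracM -tofracD !frac_derE ?mulf_neq0 //.
  by rewrite !dD !dM !(tofracB, tofracD, tofracM); apply: quotient_ruleD.
rewrite mulf_div // -!tofracM !frac_derE ?mulf_neq0 //.
by rewrite !dM !(tofracB, tofracD, tofracM); apply: quotient_ruleM.
Qed.

Lemma frac_der_tofrac (a : R) : frac_der d (tofrac a) = tofrac (d a).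
Proof.
have [_ d1] := derivation01 dP.
have {1}-> : tofrac a = tofrac a / tofrac 1 by rewrite tofrac1 divr1.
rewrite frac_derE ?oner_neq0 // d1 mulr0 subr0 mulr1 tofrac1.
by rewrite expr1n divr1.
Qed.

End FractionDerivation.

Lemma deriv_derivation (R : comNzRingType) : is_derivation (@deriv R).
Proof. by split=> p q; [exact: derivD | exact: derivM]. Qed.

Lemma map_poly_derivation (K : fieldType) (D : K -> K) :
  is_derivation D -> is_derivation (map_poly D).
Proof.
move=> DP; case: (DP) => DD DM; have [D0 _] := derivation01 DP.
have cE p i : (map_poly D p)`_i = D p`_i by rewrite coef_map_id0.
have Dsum n (F : 'I_n -> K) : D (\sum_(i < n) F i) = \sum_(i < n) D (F i).
  by apply: big_morph.
split=> p q; apply/polyP=> i; first by rewrite coefD !cE coefD DD.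
rewrite coefD !coefM !cE coefM Dsum -big_split /=.
by apply: eq_bigr => j _; rewrite DM !cE.
Qed.

Lemma map_derivationC (K : fieldType) (D : K -> K) (c : K) :
  is_derivation D -> map_poly D c%:P = (D c)%:P.
Proof.
case/derivation01=> D0 _; apply/polyP=> i.
by rewrite coef_map_id0 // !coefC; case: (i == 0%N).
Qed.

Lemma map_derivationX (K : fieldType) (D : K -> K) :
  is_derivation D -> map_poly D 'X = 0.
Proof.
case/derivation01=> D0 D1; apply/polyP=> i.
by rewrite coef_map_id0 // coefX coef0; case: (i == 1%N).
Qed.

Section StandardDerivations.

Variable k : fieldType.

Lemma Dt0_derivation : is_derivation (@Dt0 k).
Proof. exact/frac_der_derivation/deriv_derivation. Qed.

Lemma Dt0C (a : k) : Dt0 (ratC a) = 0.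
Proof.
rewrite /Dt0 /ratC frac_der_tofrac; last exact: deriv_derivation.
by rewrite derivC tofrac0.
Qed.

Lemma Dt0X : Dt0 (ratX k) = 1.
Proof.
rewrite /Dt0 /ratX frac_der_tofrac; last exact: deriv_derivation.
by rewrite derivX tofrac1.
Qed.

Lemma Dt_derivation : is_derivation (@Dt k).
Proof. exact/frac_der_derivation/map_poly_derivation/Dt0_derivation. Qed.

Lemma DtC (e : ratfun k) : Dt (ratC e) = ratC (Dt0 e).
Proof.
rewrite /Dt /ratC frac_der_tofrac ?map_derivationC.
- by [].
- exact: Dt0_derivation.
- exact/map_poly_derivation/Dt0_derivation.
Qed.

Lemma DtX : Dt (ratX (ratfun k)) = 0.
Proof.
rewrite /Dt /ratX frac_der_tofrac ?map_derivationX ?tofrac0.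
- by [].
- exact: Dt0_derivation.
- exact/map_poly_derivation/Dt0_derivation.
Qed.

Lemma Dx_derivation : is_derivation (@Dx k).
Proof. exact/frac_der_derivation/deriv_derivation. Qed.

Lemma DxC (e : ratfun k) : Dx (ratC e) = 0.
Proof.
rewrite /Dx /ratC frac_der_tofrac; last exact: deriv_derivation.
by rewrite derivC tofrac0.
Qed.

Lemma DxX : Dx (ratX (ratfun k)) = 1.
Proof.
rewrite /Dx /ratX frac_der_tofrac; last exact: deriv_derivation.
by rewrite derivX tofrac1.
Qed.

End StandardDerivations.

Section Action.

Variables (K F : fieldType) (iota : {rmorphism K -> F}).
Variables (D0 : K -> K) (D : F -> F).
Hypotheses (D0P : is_derivation D0) (DP : is_derivation D).
Hypothesis De : forall e, D (iota e) = iota (D0 e).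

Local Notation act := (diffop_act iota D).

Lemma diffop_act_widen n (L : {poly K}) y :
  (size L <= n)%N -> act L y = \sum_(i < n) iota L`_i * iter i D y.
Proof.
move=> sLn; rewrite /diffop_act (big_ord_widen n (fun i => iota L`_i * iter i D y)) //.
rewrite big_mkcond; apply: eq_bigr => i _; case: ltnP => // sLi.
by rewrite nth_default // rmorph0 mul0r.
Qed.

Lemma diffop_act_add (A B : {poly K}) y : act (A + B) y = act A y + act B y.
Proof.
set n := maxn (size A) (size B).
rewrite !(@diffop_act_widen n) ?leq_maxl ?leq_maxr ?size_polyD // -big_split /=.
by apply: eq_bigr => i _; rewrite coefD rmorphD mulrDl.
Qed.

Lemma diffop_act_scale c (A : {poly K}) y : act (c *: A) y = iota c * act A y.
Proof.
rewrite (diffop_act_widen y (size_scale_leq c A)) /diffop_act mulr_sumr.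
by apply: eq_bigr => i _; rewrite coefZ rmorphM mulrA.
Qed.

Lemma diffop_act_step (M : {poly K}) y :
  act (M * 'X + map_poly D0 M) y = D (act M y).
Proof.
case: (DP) => DD DM; have [DF0 _] := derivation01 DP.
have [D00 _] := derivation01 D0P.
rewrite diffop_act_add [in RHS]/diffop_act (big_morph D DD DF0).
rewrite (@diffop_act_widen (size M).+1 (M * 'X)); last first.
  by apply: leq_trans (size_polyMleq _ _) _; rewrite size_polyX addn2.
rewrite (@diffop_act_widen (size M) (map_poly D0 M)) ?size_poly //.
rewrite big_ord_recl coefMX /= rmorph0 mul0r add0r -big_split /=.
by apply: eq_bigr => i _; rewrite DM De coefMX coef_map_id0 //= addrC.
Qed.

Lemma diffop_act_mul (A B : {poly K}) y :
  act (diffop_mul D0 A B) y = act A (act B y).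
Proof.
have act0 : act 0 y = 0 by rewrite /diffop_act size_poly0 big_ord0.
rewrite /diffop_mul.
rewrite (big_morph (fun P => act P y) (fun P Q => diffop_act_add P Q y) act0).
apply: eq_bigr => i _; rewrite diffop_act_scale; congr (_ * _).
by elim: (i : nat) => //= j <-; rewrite diffop_act_step.
Qed.

End Action.

(* Main.v *)
(* Over K = k(t), Hermite reduction writes f as an x-derivative plus a / b with
   b squarefree, and f is an x-derivative iff all residues a(z) / b'(z), z a root
   of b in the algebraic closure, vanish.  Taking residues commutes with D_t: the
   denominator b is kept, and modulo x-derivatives D_t acts on numerators by an
   explicit derivation-like map.  Hence L(f) is an x-derivative iff L annihilates
   all residues of f.  A nonzero residue is thus an algebraic solution of L, and
   an algebraic solution y of L with minimal polynomial p is a residue of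
   x p' / p, whose other residues are the conjugates of y.  If L is a minimal
   telescoper of order n, minimality yields n residues of f with invertible
   Wronskian matrix, so they form a basis of the solutions of L. *)
Require Import Defs.
From HB Require Import structures.
From mathcomp Require Import all_boot all_order all_algebra separable ring.
From Stdlib Require Import Classical_Prop.

Set Implicit Arguments.
Unset Strict Implicit.
Unset Printing Implicit Defensive.

Import GRing.Theory.
Local Open Scope ring_scope.

(** * Polynomials and fractions *)

Lemma coprime_fraction (F : fieldType) (u : ratfun F) :
  exists a b : {poly F}, [/\ b != 0, coprimep a b & u = tofrac a / tofrac b].
Proof.
rewrite (fracE u); move: (denom_ratioP (repr u)); move: (\n__) (\d__) => a b b0.
have g0 : gcdp a b != 0 by rewrite gcdp_eq0 negb_and b0 orbT.
have ea := divpK (dvdp_gcdl a b); have eb := divpK (dvdp_gcdr a b).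
have cop : coprimep (a %/ gcdp a b) (b %/ gcdp a b).
  by rewrite coprimep_div_gcd // b0 orbT.
move: (gcdp a b) g0 (a %/ _) (b %/ _) ea eb cop => g g0 a1 b1 ea eb cop.
exists a1, b1; split=> //; first by apply: contraNneq b0 => e; rewrite -eb e mul0r.
rewrite -ea -eb !tofracM invfM mulrACA divff ?mulr1 //.
by rewrite tofrac_eq0.
Qed.

Lemma multiplicity_poly (F : fieldType) (p b : {poly F}) :
  (1 < size p)%N -> b != 0 ->
  exists m q, b = p ^+ m * q /\ ~~ (p %| q).
Proof.
move=> p1; have p0 : p != 0 by rewrite -size_poly_gt0 ltnW.
elim: {b}_.+1 {-2}b (ltnSn (size b)) => // n IHn b sb b0.
have [pb|npb] := boolP (p %| b); last by exists 0, b; rewrite expr0 mul1r.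
have eb := divpK pb; have q0 : b %/ p != 0.
  by apply: contraNneq b0 => e; rewrite -eb e mul0r.
have [|m [q [eq nq]]] := IHn (b %/ p) _ q0.
  rewrite size_divp // -ltnS; apply: leq_trans sb; rewrite ltnS.
  by rewrite ltn_subrL -subn1 subn_gt0 p1 lt0n size_poly_eq0.
by exists m.+1, q; rewrite exprS -mulrA -eq mulrC.
Qed.

Section CharZero.

Variables (F : fieldType).
Hypothesis char0 : [pchar F] =i pred0.

Lemma natr_neq0 n : n.+1%:R != 0 :> F.
Proof. by move/pcharf0P: char0 => ->. Qed.

Lemma size_deriv0 (p : {poly F}) : p^`() = 0 -> (size p <= 1)%N.
Proof.
move=> dp; apply/leq_sizeP=> -[//|j] _.
have := congr1 (fun q : {poly F} => q`_j) dp; rewrite coef_deriv coef0.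
by move/eqP; rewrite -mulr_natr mulf_eq0 (negPf (natr_neq0 _)) orbF => /eqP.
Qed.

Lemma irreducible_separable (p : {poly F}) :
  irreducible_poly p -> separable_poly p.
Proof.
move=> ip; have p1 := ip.1; have p0 : p != 0 by rewrite -size_poly_gt0 ltnW.
rewrite separable_poly.unlock irreducible_poly_coprime //.
apply/negP=> pd; have /size_deriv0 : p^`() = 0; last by rewrite leqNgt p1.
apply: contraTeq pd => dp0; apply/negP=> /(dvdp_leq dp0).
by rewrite leqNgt lt_size_deriv.
Qed.

Lemma poly_antiderivative (p : {poly F}) : exists q : {poly F}, q^`() = p.
Proof.
(* At [i = 0] the coefficient is a division by zero, hence 0; differentiation drops it anyway. *)
exists (\poly_(i < (size p).+1) (p`_i.-1 / i%:R)); apply/polyP=> i.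
rewrite coef_deriv coef_poly ltnS; case: ltnP => [_|/leq_sizeP->] //.
  by rewrite -[LHS]mulr_natr divfK // natr_neq0.
by rewrite mul0rn.
Qed.

End CharZero.

Section Roots.

Variables (F E : fieldType) (iota : {rmorphism F -> E}).

Local Notation "p ^i" := (map_poly iota p) (at level 2, format "p ^i").

(** Descent on size to an annihilating polynomial of least size; it divides any other because the
    remainder also vanishes at [u]. *)
Lemma minimal_polynomial (u : E) : algebraicOver iota u ->
  exists p : {poly F}, [/\ p != 0, root p^i u &
    forall q : {poly F}, root q^i u -> p %| q].
Proof.
case=> p p0 pu; elim: {p}_.+1 {-2}p (ltnSn (size p)) p0 pu => // n IHn p sp p0 pu.
have [[q [q0 qu sq]]|minp] :=
  classic (exists q : {poly F}, [/\ q != 0, root q^i u & (size q < size p)%N]).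
  by apply: (IHn q) => //; rewrite -ltnS; apply: leq_trans sp; rewrite ltnS.
exists p; split=> // q qu; apply/modp_eq0P/eqP/negP=> /negP r0.
case: minp; exists (q %% p); split; rewrite ?ltn_modp //.
move: qu; rewrite {1}(divp_eq q p) rmorphD rmorphM /= !rootE hornerD hornerM.
by rewrite (rootP pu) mulr0 add0r.
Qed.

Lemma minimal_irreducible (u : E) (p : {poly F}) :
  p != 0 -> root p^i u -> (forall q, root q^i u -> p %| q) ->
  irreducible_poly p.
Proof.
move=> p0 pu minp; split.
  rewrite ltnNge; apply/negP=> /size1_polyC e; move: pu.
  rewrite e map_polyC rootC fmorph_eq0 => /eqP c0.
  by rewrite e c0 polyC0 eqxx in p0.
move=> q sq qp; rewrite /eqp qp /=.
have ep := divpK qp; move: pu; rewrite -{1}ep rmorphM rootM => /orP[|]; last first.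
  exact: minp.
move/minp/dvdp_leq; have h0 : p %/ q != 0.
  by apply: contraNneq p0 => e; rewrite -ep e mul0r.
have q0 : q != 0 by apply: contraNneq p0 => e; rewrite -ep e mulr0.
move/(_ h0); rewrite size_divp // => le.
case/eqP: sq; move: le; have := size_poly_gt0 q; have := size_poly_gt0 p.
rewrite p0 q0; case: (size q) (size p) => [|[|m]] // [|n] // _ _.
by rewrite subSS leqNgt ltnS leq_subr.
Qed.

End Roots.

Section ClosedRoots.

Variables (F : fieldType) (E : closedFieldType) (iota : {rmorphism F -> E}).

Local Notation "p ^i" := (map_poly iota p) (at level 2, format "p ^i").

Lemma separable_root_deriv (b : {poly F}) (u : E) :
  separable_poly b -> root b^i u -> b^i^`().[u] != 0.
Proof.
rewrite -(separable_map iota) separable_poly.unlock => sb bu.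
exact: coprimep_root sb bu.
Qed.

(** A root of [b %/ gcdp a b] would also be a root of the gcd, hence a double root of [b]; so this
    cofactor is constant. *)
Lemma separable_dvdp (a b : {poly F}) : separable_poly b ->
  (forall u, root b^i u -> root a^i u) -> b %| a.
Proof.
move=> sb ba; have b0 := separable_poly_neq0 sb.
have eb := divpK (dvdp_gcdr a b); set g := gcdp a b in eb *.
have [/size_poly1P[c c0 e]|] := boolP (size (b %/ g) == 1%N).
  apply: dvdp_trans (dvdp_gcdl a b). rewrite -{1}eb e mul_polyC.
  by rewrite dvdpZl.
rewrite -(size_map_poly iota) => /closed_rootP[u hu].
have bu : root b^i u by rewrite -eb rmorphM rootM hu.
have gu : root g^i u by rewrite gcdp_map root_gcd ba.
have := separable_root_deriv sb bu.
by rewrite -eb rmorphM derivM hornerD !hornerM (rootP hu) (rootP gu) mul0r mulr0 addr0 eqxx.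
Qed.

End ClosedRoots.

(** * Exact rational functions and Hermite reduction *)

Section Derivations.

Variables (R : nzRingType) (D : R -> R).
Hypothesis DP : is_derivation D.

Lemma derivation_sum I (r : seq I) (P : pred I) (f : I -> R) :
  D (\sum_(i <- r | P i) f i) = \sum_(i <- r | P i) D (f i).
Proof. exact: (big_morph D DP.1 (derivation01 DP).1). Qed.

Lemma derivationN a : D (- a) = - D a.
Proof. by apply/eqP; rewrite -addr_eq0 -DP.1 addNr (derivation01 DP).1. Qed.

Lemma derivationB a b : D (a - b) = D a - D b.
Proof. by rewrite DP.1 derivationN. Qed.

Lemma derivationMn a n : D (a *+ n) = D a *+ n.
Proof.
by elim: n => [|n IHn]; rewrite ?mulr0n ?(derivation01 DP).1 // !mulrS DP.1 IHn.
Qed.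

End Derivations.

Lemma derivation_div (F : fieldType) (D : F -> F) (a b : F) :
  is_derivation D -> b != 0 -> D (a / b) = (D a * b - a * D b) / b ^+ 2.
Proof.
move=> DP b0; have e : D a = D (a / b) * b + a / b * D b by rewrite -DP.2 divfK.
by rewrite e; field.
Qed.

Lemma deriv_map_derivation (F : fieldType) (D : F -> F) (p : {poly F}) :
  is_derivation D -> (map_poly D p)^`() = map_poly D p^`().
Proof.
move=> DP; have D0 := (derivation01 DP).1; apply/polyP=> i.
by rewrite coef_deriv !coef_map_id0 // coef_deriv derivationMn.
Qed.

(** Integration by parts for [hermite_step], where [as_], [n] and [pm] stand for [a * s], [m.+1] and
    [p ^+ m]. *)
Lemma hermite_identity (F : fieldType) (as_ U n U' p p' pm q : F) :
  p != 0 -> q != 0 -> pm != 0 ->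
  (as_ * p + U * n * p' * q) / (p * (p * pm) * q) -
  (as_ + U' * q) / (p * pm * q) =
  - ((U' * (p * pm) - U * (p' * pm * n)) / (p * pm * (p * pm))).
Proof. by move=> p0 q0 pm0; field; rewrite p0 q0 pm0. Qed.

Section Exactness.

Variable F : fieldType.
Implicit Types (a b p : {poly F}) (u v : ratfun F).

Local Notation dx := (frac_der (@deriv F)).
Let dxP : is_derivation dx := frac_der_derivation (@deriv_derivation F).

Definition exact u := exists g, u = dx g.

Lemma exactD u v : exact u -> exact v -> exact (u + v).
Proof. by case=> g -> [h ->]; exists (g + h); rewrite dxP.1. Qed.

Lemma exactN u : exact u -> exact (- u).
Proof. by case=> g ->; exists (- g); rewrite derivationN. Qed.

Lemma exactB u v : exact u -> exact v -> exact (u - v).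
Proof. by move=> eu ev; apply/exactD/exactN. Qed.

Lemma exact0 : exact 0.
Proof. by exists 0; rewrite (derivation01 dxP).1. Qed.

Lemma exact_scale (c : F) u : exact u -> exact (ratC c * u).
Proof.
case=> g ->; exists (ratC c * g); rewrite dxP.2 /ratC frac_der_tofrac.
  by rewrite derivC tofrac0 mul0r add0r.
exact: deriv_derivation.
Qed.

Lemma exact_congr u v : exact (u - v) -> exact u <-> exact v.
Proof.
move=> euv; split=> [eu|ev]; last by rewrite -(subrK v u); apply: exactD.
by rewrite -(subKr u v); apply: exactB.
Qed.

Lemma exact_sum I (r : seq I) (P : pred I) (f : I -> ratfun F) :
  (forall i, P i -> exact (f i)) -> exact (\sum_(i <- r | P i) f i).
Proof. by move=> ef; apply: big_ind => //; [exact: exact0 | exact: exactD]. Qed.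

(** The two derivations commute on polynomials, and the quotient rule carries this over to
    fractions. Hence D_t preserves exactness. *)
Lemma frac_der_comm (D : F -> F) u : is_derivation D ->
  dx (frac_der (map_poly D) u) = frac_der (map_poly D) (dx u).
Proof.
move=> DP; have mP := map_poly_derivation DP; have dP := @deriv_derivation F.
have [a [b [b0 _ ->]]] := coprime_fraction u.
rewrite !frac_derE // -!tofracXn !frac_derE ?expf_neq0 // -!tofracXn.
congr (tofrac _ / _); rewrite !expr2 !(derivationB dP, derivationB mP, dP.2, mP.2).
by rewrite !deriv_map_derivation //; ring.
Qed.

Lemma exact_frac_der (D : F -> F) u : is_derivation D ->
  exact u -> exact (frac_der (map_poly D) u).
Proof.
by move=> DP [g ->]; exists (frac_der (map_poly D) g); rewrite frac_der_comm.
Qed.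

Hypothesis char0 : [pchar F] =i pred0.

Lemma exact_tofrac p : exact (tofrac p).
Proof.
have [q <-] := poly_antiderivative char0 p; exists (tofrac q).
by rewrite frac_der_tofrac //; apply: deriv_derivation.
Qed.

Lemma exact_dvdp a b : b %| a -> exact (tofrac a / tofrac b).
Proof.
move=> ba; have [->|b0] := eqVneq b 0.
  by rewrite tofrac0 invr0 mulr0; apply: exact0.
rewrite -(divpK ba) tofracM mulfK ?tofrac_eq0 //; exact: exact_tofrac.
Qed.

(* With s p + t p' q = 1, integration by parts lowers the exponent of p. *)
Lemma hermite_step p q a m : p != 0 -> q != 0 ->
  coprimep p (p^`() * q) ->
  exists a1, exact (tofrac a / tofrac (p ^+ m.+2 * q) -
                    tofrac a1 / tofrac (p ^+ m.+1 * q)).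
Proof.
move=> p0 q0 /Bezout_eq1_coprimepP[[s t] /= st1].
have n0 := natr_neq0 char0 m.
(* The constant [c] cancels the factor [m.+1] from differentiating [p ^+ m.+1], so that U / p^(m+1)
   has derivative U' / p^(m+1) - a t p' / p^(m+2). *)
pose c := (m.+1%:R^-1 : F); pose U := c *: (a * t).
exists (a * s + U^`() * q), (- (tofrac U / tofrac (p ^+ m.+1))).
have dP := @deriv_derivation F.
rewrite (derivationN dxP) frac_derE ?expf_neq0 //.
have eU : a = a * s * p + U * m.+1%:R * p^`() * q.
  have -> : U * m.+1%:R = a * t.
    by rewrite mulr_natr /U scalerMnl -[_ *+ _]mulr_natr mulVf // scale1r.
  by rewrite -[LHS]mulr1 -st1; ring.
rewrite deriv_exp /= -[_ *+ m.+1]mulr_natr {1}eU; clear eU.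
move: U (_%:R) (p^`()) (U^`()) => U0 n p' U'.
rewrite !(tofracD, tofracM, tofracN, tofracXn) expr2 !exprS.
have fp0 : tofrac p != 0 by rewrite tofrac_eq0.
have fq0 : tofrac q != 0 by rewrite tofrac_eq0.
exact: hermite_identity fp0 fq0 (expf_neq0 m fp0).
Qed.

End Exactness.

(** Cross-multiplied form of (u / v)' = a / b with [y] for X - z, b = B0 y and [e] for w'. Once
    y^(n+1) is cancelled, only - (n+1) u w B0 survives at y = 0. *)
Lemma pole_identity (R : comNzRingType) (u u' v v' y a w B0 e : R) (n : nat) :
  v = w * y ^+ n.+1 -> v' = e * y ^+ n.+1 + w * (y ^+ n *+ n.+1) ->
  (u' * v - u * v') * (B0 * y) - a * v ^+ 2 =
  y ^+ n.+1 * ((u' * w - u * e) * B0 * y - u * w * n.+1%:R * B0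
     - a * w ^+ 2 * y ^+ n.+1).
Proof. by move=> -> ->; rewrite -[y ^+ n *+ n.+1]mulr_natr !exprS; ring. Qed.

Section ClosedExact.

Variables (F : fieldType) (E : closedFieldType) (iota : {rmorphism F -> E}).
Hypothesis char0 : [pchar F] =i pred0.
Hypothesis iota_alg : is_algebraic_closure iota.

Local Notation "p ^i" := (map_poly iota p) (at level 2, format "p ^i").

(** Induction on the size of the denominator: the minimal polynomial of a multiple root of [b]
    divides [b] at least twice, and [hermite_step] removes one factor. *)
Lemma hermite_reduction (u : ratfun F) :
  exists a b, separable_poly b /\ exact (u - tofrac a / tofrac b).
Proof.
have [a [b [b0 _ ->]]] := coprime_fraction u.
elim: {b}_.+1 {-2}b (ltnSn (size b)) b0 a => // n IHn b sb b0 a.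
have [sepb|] := boolP (separable_poly b).
  by exists a, b; rewrite subrr; split=> //; apply: exact0.
rewrite {1}separable_poly.unlock {1}/coprimep -(size_map_poly iota).
move=> /closed_rootP[z]; rewrite gcdp_map root_gcd => /andP[bz b'z].
have [p [p0 pz minp]] := minimal_polynomial (iota_alg z).
have ip := minimal_irreducible p0 pz minp.
have cpp' : coprimep p p^`().
  by have := irreducible_separable char0 ip; rewrite separable_poly.unlock.
have pb := minp _ bz; have pb' := minp _ b'z.
have [m [q [eb npq]]] := multiplicity_poly ip.1 b0.
have cpq : coprimep p q by rewrite irreducible_poly_coprime.
have q0 : q != 0 by apply: contraNneq npq => ->; rewrite dvdp0.
(* Multiplicity 0 contradicts p | b; multiplicity 1 would turn p | b' into p | p' q, hence p | q. *)
case: m eb => [|[|m]] eb.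
- by case/negP: npq; move: pb; rewrite eb expr0 mul1r.
- case/negP: npq; move: pb'; rewrite eb expr1 derivM.
  by rewrite dvdp_addl ?(dvdp_mulr _ (dvdpp p)) // Gauss_dvdpr.
have [|a1 ea1] := @hermite_step _ char0 p q a m p0 q0.
  by rewrite coprimepMr cpp'.
have q1 : p ^+ m.+1 * q != 0 by rewrite mulf_neq0 ?expf_neq0.
have [|a2 [b2 [sb2 e2]]] := IHn (p ^+ m.+1 * q) _ q1 a1.
  apply: leq_trans (_ : size b <= n)%N; last by rewrite -ltnS.
  rewrite eb [p ^+ m.+2]exprS -mulrA [size (p * _)]size_mul //.
  by have := ip.1; case: (size p) => [|[|s]] // _; rewrite addSn /= addSn ltnS leq_addl.
exists a2, b2; split=> //; rewrite eb.
by have := exactD ea1 e2; rewrite addrA subrK.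
Qed.

(* A derivative has no simple pole: if v vanishes to order n.+1 at z and u does
   not vanish there, then (u' v - u v') / v^2 has a pole of order n.+2. *)
Lemma exact_root (a b : {poly F}) (z : E) : separable_poly b ->
  exact (tofrac a / tofrac b) -> root b^i z -> root a^i z.
Proof.
move=> sb [g]; have b0 := separable_poly_neq0 sb.
have [u [v [v0 cuv ->]]] := coprime_fraction g.
rewrite frac_derE //; last exact: deriv_derivation.
move=> /eqP; rewrite eqr_div ?expf_neq0 ?tofrac_eq0 // -!tofracXn -!tofracM.
rewrite tofrac_eq => /eqP/(congr1 (map_poly iota)).
rewrite !(rmorphXn, rmorphM, rmorphB) /= -!deriv_map => e bz.
have b'z := separable_root_deriv sb bz.
have vi0 : v^i != 0 by rewrite map_poly_eq0.
(* If v(z) is nonzero, evaluating a v^2 = (u' v - u v') b at [z] already gives a(z) = 0. *)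
have [[|n] [w]] := multiplicity_XsubC v^i z; rewrite vi0 /= => wz ev.
  have := congr1 (horner^~ z) e; rewrite ev expr0 mulr1 !hornerM.
  by rewrite (rootP bz) mulr0 => /eqP; rewrite !mulf_eq0 -!rootE (negPf wz) !orbF.
have uz : u^i.[z] != 0.
  have : coprimep v^i u^i by rewrite coprimep_map coprimep_sym.
  move/coprimep_root; apply; rewrite ev rootM root_exp_XsubC eqxx.
  by rewrite orbT.
have [B0 eB] := factor_theorem _ _ bz.
have B0z : B0.[z] != 0.
  move: b'z; rewrite eB derivM derivXsubC mulr1 hornerD hornerM.
  by rewrite hornerXsubC subrr mulr0 add0r.
have dv : (v^i)^`() = w^`() * ('X - z%:P) ^+ n.+1 +
   w * (('X - z%:P) ^+ n *+ n.+1).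
  by rewrite ev derivM deriv_exp derivXsubC mul1r.
have := pole_identity u^i (u^i)^`() a^i B0 ev dv.
rewrite -eB -e subrr => /esym/eqP; rewrite mulf_eq0 expf_eq0 polyXsubC_eq0 /=.
move=> /eqP/(congr1 (horner^~ z)); rewrite !(horner_exp, hornerD, hornerN, hornerM).
rewrite horner0 -polyC_natr hornerX !hornerC subrr expr0n /= !mulr0 subr0 add0r => /eqP.
rewrite oppr_eq0 !mulf_eq0 (negPf uz) (negPf B0z) -rootE (negPf wz) orbF /=.
by rewrite -(rmorph_nat iota) fmorph_eq0 (negPf (natr_neq0 char0 n)).
Qed.

Lemma exact_fraction (a b : {poly F}) : separable_poly b ->
  exact (tofrac a / tofrac b) <-> (forall z, root b^i z -> root a^i z).
Proof.
move=> sb; split=> [eab z|ba]; first exact: exact_root.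
exact/exact_dvdp/(separable_dvdp sb ba).
Qed.

End ClosedExact.

(** * Residues and the derivation with respect to t *)

Lemma reduction_identity (F : fieldType) (a a' b b' v v' w Da : F) : b != 0 ->
  (Da * b - a * (w * b - v * b')) / b ^+ 2 -
    (Da + (a' * v + a * v') - a * w) / b =
  - (((a' * v + a * v') * b - a * v * b') / b ^+ 2).
Proof. by move=> b0; field. Qed.

(** The second hypothesis is the x-derivative of D(b) = w b - v b' taken at a root of [b], where the
    term w' b vanishes. *)
Lemma residue_identity (F : fieldType) (a Da a' v v' w b' b'' Db' : F) :
  b' != 0 -> Db' + b'' * v = w * b' - v' * b' ->
  ((Da + a' * v) * b' - a * (Db' + b'' * v)) / b' ^+ 2 =
  (Da + (a' * v + a * v') - a * w) / b'.
Proof. by move=> b0 ->; field. Qed.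

(** Chain rule, by induction on the Horner form of [p]. *)
Lemma derivation_horner (F E : fieldType) (iota : {rmorphism F -> E})
    (D : F -> F) (DE : E -> E) (p : {poly F}) (z : E) :
  is_derivation D -> is_derivation DE ->
  (forall e, DE (iota e) = iota (D e)) ->
  DE (map_poly iota p).[z] =
  (map_poly iota (map_poly D p)).[z] + (map_poly iota p^`()).[z] * DE z.
Proof.
move=> DP DEP DEiota; have mDP := map_poly_derivation DP.
have DE0 := (derivation01 DEP).1; have mD0 := (derivation01 mDP).1.
elim/poly_ind: p => [|p c IHp].
  by rewrite mD0 deriv0 !rmorph0 horner0 DE0 mul0r addr0.
rewrite mDP.1 mDP.2 map_derivationX // map_derivationC // mulr0 addr0.
rewrite derivD derivM derivX derivC addr0 mulr1.
rewrite !(rmorphD, rmorphM) /= !map_polyX !map_polyC !(hornerD, hornerM) /=.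
by rewrite !hornerX !hornerC DEP.1 DEP.2 IHp DEiota; ring.
Qed.

Section ReducedForms.

Variables (F : fieldType) (E : closedFieldType) (iota : {rmorphism F -> E}).
Variables (D : F -> F) (DE : E -> E).
Hypothesis char0 : [pchar F] =i pred0.
Hypothesis iota_alg : is_algebraic_closure iota.
Hypotheses (DP : is_derivation D) (DEP : is_derivation DE).
Hypothesis DEiota : forall e, DE (iota e) = iota (D e).

Local Notation "p ^i" := (map_poly iota p) (at level 2, format "p ^i").
Local Notation dt := (frac_der (map_poly D)).
Let mDP : is_derivation (map_poly D) := map_poly_derivation DP.

(** At a root z of [b], differentiating b(z) = 0 shows that D z = v(z): thus [v] interpolates the
    motion of the roots. A Bezout relation between [b] and [b'] supplies [v] and [w], see
    [separable_der_eq]. *)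
Variables (b v w : {poly F}).
Hypothesis sep_b : separable_poly b.
Hypothesis Db : map_poly D b = w * b - v * b^`().

Let b0 : b != 0 := separable_poly_neq0 sep_b.

(* dt (a / b) is congruent to reduced_der a / b modulo derivatives. *)
Definition reduced_der (a : {poly F}) : {poly F} :=
  map_poly D a + (a * v)^`() - a * w.

Definition residue (a : {poly F}) (z : E) : E := a^i.[z] / b^i^`().[z].

Lemma root_derivation z : root b^i z -> DE z = v^i.[z].
Proof.
move=> bz; have b'z := separable_root_deriv sep_b bz.
have := derivation_horner b z DP DEP DEiota; rewrite (rootP bz) (derivation01 DEP).1 Db.
rewrite -deriv_map rmorphB !rmorphM /= -deriv_map hornerD hornerN !hornerM.
rewrite (rootP bz) mulr0 add0r addrC mulrC -mulrBl => /esym/eqP.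
by rewrite mulf_eq0 (negPf b'z) orbF subr_eq0 => /eqP.
Qed.

Lemma residue_reduced_der a z :
  root b^i z -> DE (residue a z) = residue (reduced_der a) z.
Proof.
move=> bz; have b'z := separable_root_deriv sep_b bz.
rewrite /residue derivation_div // [in X in _ - _ * X]deriv_map
  !(derivation_horner _ _ DP DEP DEiota).
rewrite (root_derivation bz) /reduced_der !(rmorphB, rmorphD, rmorphM) /=.
rewrite derivM rmorphD !rmorphM /= !(hornerD, hornerN, hornerM) -!deriv_map.
apply: residue_identity => //.
rewrite -deriv_map_derivation // Db derivB !derivM !(rmorphB, rmorphD, rmorphM) /=.
rewrite -!deriv_map !(hornerD, hornerN, hornerM) (rootP bz); ring.
Qed.

Lemma reduced_der_exact a :
  exact (dt (tofrac a / tofrac b) - tofrac (reduced_der a) / tofrac b).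
Proof.
have dP := @deriv_derivation F.
(* The double-pole part of dt (a / b) is a v b' / b^2, and adding the x-derivative of a v / b
   replaces it by (a v)' / b. *)
exists (- (tofrac (a * v) / tofrac b)).
rewrite (derivationN (frac_der_derivation dP)) !frac_derE // /reduced_der Db.
rewrite !derivM !(tofracD, tofracM, tofracB, tofracN).
by apply: reduction_identity; rewrite tofrac_eq0.
Qed.

Lemma reduced_der_congr u a : exact (u - tofrac a / tofrac b) ->
  exact (dt u - tofrac (reduced_der a) / tofrac b).
Proof.
move=> /(exact_frac_der DP); rewrite (derivationB (frac_der_derivation mDP)).
by move/exactD/(_ (reduced_der_exact a)); rewrite addrA subrK.
Qed.

(** The analogue of [diffop_act] on numerators, which form a ring and not a field. *)
Definition reduced_act (L a : {poly F}) : {poly F} :=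
  \sum_(i < size L) L`_i *: iter i reduced_der a.

Lemma reduced_act_congr L u a : exact (u - tofrac a / tofrac b) ->
  exact (diffop_act (@ratC F) dt L u - tofrac (reduced_act L a) / tofrac b).
Proof.
move=> eua; rewrite /diffop_act /reduced_act.
rewrite (big_morph _ (@tofracD _) (@tofrac0 _)) mulr_suml -sumrB.
apply: exact_sum => i _; rewrite -mul_polyC tofracM -mulrA -mulrBr.
apply: exact_scale; elim: (i : nat) => //= j; exact: reduced_der_congr.
Qed.

Lemma residue_iter a z j : root b^i z ->
  iter j DE (residue a z) = residue (iter j reduced_der a) z.
Proof. by move=> bz; elim: j => //= j ->; apply: residue_reduced_der. Qed.

Lemma residue_reduced_act L a z : root b^i z ->
  diffop_act iota DE L (residue a z) = residue (reduced_act L a) z.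
Proof.
move=> bz; rewrite /reduced_act /residue rmorph_sum horner_sum mulr_suml.
apply: eq_bigr => i _; rewrite residue_iter // /residue.
by rewrite /= map_polyZ hornerZ mulrA.
Qed.

Lemma residue_eq0 a z : root b^i z -> (residue a z == 0) = root a^i z.
Proof.
move=> bz; rewrite mulf_eq0 invr_eq0.
by rewrite (negPf (separable_root_deriv sep_b bz)) orbF.
Qed.

Lemma exact_residues u a : exact (u - tofrac a / tofrac b) ->
  exact u <-> forall z, root b^i z -> residue a z = 0.
Proof.
move=> eua; apply: (iff_trans (exact_congr eua)).
apply: iff_trans (exact_fraction iota char0 a sep_b) _.
split=> H z bz; first by apply/eqP; rewrite residue_eq0 ?H.
by rewrite -residue_eq0 // H.
Qed.

(** L(u) has a reduced form over the same [b], and its residues are the images under [L] of those of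
    [u]. *)
Lemma exact_act_residues L u a : exact (u - tofrac a / tofrac b) ->
  exact (diffop_act (@ratC F) dt L u) <->
  forall z, root b^i z -> diffop_act iota DE L (residue a z) = 0.
Proof.
move=> /(reduced_act_congr L) eL; apply: (iff_trans (exact_residues eL)).
by split=> H z bz; have := H z bz; rewrite residue_reduced_act.
Qed.

End ReducedForms.

Lemma separable_der_eq (F : fieldType) (D : F -> F) (b : {poly F}) :
  separable_poly b ->
  exists v w, map_poly D b = w * b - v * b^`().
Proof.
rewrite separable_poly.unlock => /Bezout_eq1_coprimepP[[s t] /= st].
exists (- (map_poly D b * t)), (map_poly D b * s).
by rewrite mulNr opprK -!mulrA -mulrDr st mulr1.
Qed.

(** * Constants, operators and fundamental systems *)

(** In lowest terms a' b = a b' forces b | b', so b' = 0 by degree, and then a' = 0. *)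
Lemma ratfun_constants (k : fieldType) (u : ratfun k) :
  [pchar k] =i pred0 -> Dt0 u = 0 -> exists c, u = ratC c.
Proof.
move=> char0; have [a [b [b0 cab ->]]] := coprime_fraction u.
rewrite /Dt0 frac_derE //; last exact: deriv_derivation.
move/eqP; rewrite mulf_eq0 invr_eq0 expf_eq0 !tofrac_eq0 (negPf b0) andbF orbF.
rewrite subr_eq0 => /eqP e.
have b'0 : b^`() = 0.
  apply/eqP; apply/negP=> /negP b'0; have := lt_size_deriv b0.
  rewrite ltnNge dvdp_leq // -(@Gauss_dvdpr _ b^`() a) 1?coprimep_sym //.
  by rewrite -e dvdp_mulIr.
have a'0 : a^`() = 0.
  by apply: (mulIf b0); rewrite e b'0 mulr0 mul0r.
have /size1_polyC ea := size_deriv0 char0 a'0.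
have /size1_polyC eb := size_deriv0 char0 b'0.
by exists (a`_0 / b`_0); rewrite rmorphM fmorphV /= /ratC -ea -eb.
Qed.

(** If [p] is the monic minimal polynomial of [u], then D(p) also vanishes at [u] but has smaller
    size, since D(1) = 0. So D(p) = 0, [p] has coefficients in [k], and it splits there. *)
Lemma algebraic_constants (k : closedFieldType) (K E : fieldType)
    (c : {rmorphism k -> K}) (iota : {rmorphism K -> E})
    (D : K -> K) (DE : E -> E) :
  is_derivation D -> is_derivation DE ->
  (forall e, DE (iota e) = iota (D e)) ->
  (forall e, D e = 0 -> exists a, e = c a) ->
  forall u, algebraicOver iota u -> DE u = 0 -> exists a, u = iota (c a).
Proof.
move=> DP DEP DEiota cstD u ualg DEu.
have [p0 [p0_neq0 p0u minp0]] := minimal_polynomial ualg.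
have lp0 : lead_coef p0 != 0 by rewrite lead_coef_eq0.
pose p := (lead_coef p0)^-1 *: p0.
have mp : p \is monic by rewrite monicE lead_coefZ mulVf.
have pu : root (map_poly iota p) u.
  by rewrite /p map_polyZ rootZ // fmorphV invr_eq0 fmorph_eq0.
have minp q : root (map_poly iota q) u -> p %| q.
  by move/minp0; rewrite /p dvdpZl ?invr_eq0.
have [D0 D1] := derivation01 DP.
have Dp0 : map_poly D p = 0.
  apply/eqP; apply/negP=> /negP Dp_neq0.
  have /minp/(dvdp_leq Dp_neq0) : root (map_poly iota (map_poly D p)) u.
    have := derivation_horner p u DP DEP DEiota.
    by rewrite DEu mulr0 addr0 (rootP pu) (derivation01 DEP).1 => /esym/rootP.
  apply/negP; rewrite -ltnNge; have := monic_neq0 mp.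
  rewrite -size_poly_gt0; case es: (size p) => [//|n] _.
  rewrite ltnS; apply/leq_sizeP=> j; rewrite leq_eqVlt coef_map_id0 //.
  case/predU1P=> [<-|nj]; last by rewrite nth_default ?es // D0.
  by move: mp; rewrite monicE lead_coefE es /= => /eqP->.
have cst i : exists a, p`_i = c a.
  apply: cstD; have := congr1 (fun q : {poly K} => q`_i) Dp0.
  by rewrite coef_map_id0 // coef0.
have [q eq] : exists q, p = map_poly c q.
  have [a ea] := fin_all_exists (fun i : 'I_(size p) => cst i).
  exists (\poly_(i < size p) oapp a 0 (insub i)); apply/polyP=> i.
  rewrite coef_map coef_poly; case: ltnP => [lti|gei]; last first.
    by rewrite nth_default //; apply/esym/rmorph0.
  by rewrite insubT /= -ea.
have [r er] := closed_field_poly_normal q.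
have lq : lead_coef q = 1.
  by apply: (fmorph_inj c); rewrite rmorph1 -lead_coef_map -eq (monicP mp).
have := pu; rewrite eq er lq scale1r !rmorph_prod /= /root horner_prod.
rewrite prodf_seq_eq0 => /hasP[z _] /=; rewrite map_polyXsubC map_polyXsubC hornerXsubC.
by rewrite subr_eq0 => /eqP ->; exists z.
Qed.

Section OperatorProduct.

Variables (K : fieldType) (D : K -> K).

Local Notation step := (fun M : {poly K} => M * 'X + map_poly D M).

(** [step] is left multiplication by the derivation symbol; its summand [map_poly D M] has lower
    order and leaves the leading term alone. *)
Lemma iter_step_monic (L : {poly K}) i : L \is monic ->
  iter i step L \is monic /\ size (iter i step L) = (size L + i)%N.
Proof.
move=> mL; elim: i => [|i [IHm IHs]]; first by rewrite addn0.
have s1 : size (iter i step L * 'X) = (size (iter i step L)).+1.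
  by rewrite size_mulX // monic_neq0.
have s2 : (size (map_poly D (iter i step L)) < size (iter i step L * 'X)%R)%N.
  by rewrite s1 ltnS size_poly.
rewrite /= monicE lead_coefDl // lead_coefMX -monicE IHm; split=> //.
by rewrite size_polyDl // s1 IHs addnS.
Qed.

(** With n the order of [A], the coefficient of index [(size L).-1 + n] comes from the leading term
    of [A] alone, so it is nonzero. *)
Lemma size_diffop_mul (A L : {poly K}) : L \is monic -> A != 0 ->
  (size L <= size (diffop_mul D A L))%N.
Proof.
move=> mL A0; have sL : (0 < size L)%N by rewrite size_poly_gt0 monic_neq0.
move: A0; rewrite -lead_coef_eq0 lead_coefE /diffop_mul.
case es: (size A) => [|n] lA0.
  by rewrite nth_default ?eqxx ?es in lA0.
apply: leq_trans (leq_addr n _) _; rewrite -(prednK sL) addSn.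
rewrite ltnNge; apply/negP=> /leq_sizeP/(_ _ (leqnn _))/eqP; apply/negP.
rewrite coef_sum big_ord_recr /= big1 => [|i _].
  have [mM sM] := iter_step_monic n mL.
  rewrite add0r coefZ mulf_neq0 //.
  have -> : ((size L).-1 + n)%N = (size (iter n step L)).-1.
    by rewrite sM -{2}(prednK sL).
  by rewrite -lead_coefE (monicP mM) oner_eq0.
have [_ sM] := iter_step_monic i mL.
rewrite coefZ /= [X in _ * X]nth_default ?mulr0 // sM -{1}(prednK sL) addSn.
by rewrite ltn_add2l.
Qed.

End OperatorProduct.

(** Variation of constants: the invertible Wronskian matrix expresses a solution and its first
    derivatives by common coefficients, which turn out to be constants. *)
Lemma wronskian_basis (k K E : fieldType) (c : {rmorphism k -> E})
    (iota : {rmorphism K -> E}) (DE : E -> E) (L : {poly K}) n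
    (b : 'I_n -> E) :
  is_derivation DE ->
  (forall a, DE (c a) = 0) -> (forall u, DE u = 0 -> exists a, u = c a) ->
  size L = n.+1 -> (forall i, diffop_act iota DE L (b i) = 0) ->
  \matrix_(i < n, j < n) iter j DE (b i) \in unitmx ->
  has_dimension c (fun y => diffop_act iota DE L y = 0) n.
Proof.
move=> DEP DEc cst sL Lb; set U := \matrix_(_, _) _ => Uu.
have iterE j (a : 'I_n -> k) :
    iter j DE (\sum_i c (a i) * b i) = \sum_i c (a i) * iter j DE (b i).
  elim: j => //= j ->; rewrite derivation_sum //; apply: eq_bigr => i _.
  by rewrite DEP.2 DEc mul0r add0r.
exists b; split=> [a a0 i|y].
  have : (\row_i c (a i)) *m U = 0.
    apply/rowP=> j; rewrite !mxE.
    under eq_bigr do rewrite !mxE.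
    rewrite -iterE a0; elim: (j : nat) => //= m ->.
    by rewrite (derivation01 DEP).1.
  move/(congr1 (mulmx^~ (invmx U))); rewrite mulmxK // mul0mx => /rowP/(_ i).
  by rewrite !mxE => /eqP; rewrite fmorph_eq0 => /eqP.
split=> [Ly|[a ->]]; last first.
  rewrite /diffop_act; under eq_bigr do rewrite iterE mulr_sumr.
  rewrite exchange_big big1 //= => i _.
  under eq_bigr do rewrite mulrCA.
  by rewrite -mulr_sumr -[X in _ * X]/(diffop_act iota DE L (b i)) Lb mulr0.
have [C CU] : exists C : 'rV_n, C *m U = \row_(j < n) iter j DE y.
  by exists ((\row_(j < n) iter j DE y) *m invmx U); rewrite mulmxKV.
have Clt (j : 'I_n) : iter j DE y = \sum_i C 0 i * iter j DE (b i).
  have /rowP/(_ j) := CU; rewrite !mxE => <-.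
  by apply: eq_bigr => i _; rewrite mxE.
(* Order [n] follows from the lower orders because [L] kills [y] and every [b i] and has a nonzero
   leading coefficient. *)
have Cle j : (j <= n)%N -> iter j DE y = \sum_i C 0 i * iter j DE (b i).
  rewrite leq_eqVlt => /predU1P[->|jn]; last exact: (Clt (Ordinal jn)).
  have Ln0 : iota L`_n != 0.
    by rewrite fmorph_eq0 -[n]/(n.+1.-1) -sL -lead_coefE lead_coef_eq0
      -size_poly_gt0 sL.
  have top z : diffop_act iota DE L z = 0 ->
      iota L`_n * iter n DE z = - \sum_(i < n) iota L`_i * iter i DE z.
    rewrite /diffop_act sL big_ord_recr /= => /eqP.
    by rewrite addr_eq0 => /eqP->; rewrite opprK.
  apply: (mulfI Ln0); rewrite top // mulr_sumr.
  under [RHS]eq_bigr => i _ do rewrite mulrCA top // mulrN mulr_sumr.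
  rewrite sumrN exchange_big /=; congr (- _); apply: eq_bigr => i _.
  rewrite Clt mulr_sumr; apply: eq_bigr => j' _; exact: mulrCA.
(* Differentiate the relation of order [j] and subtract the one of order [j.+1], available up to
   [n]. *)
have DC : (\row_i DE (C 0 i)) *m U = 0.
  apply/rowP=> j; rewrite !mxE; under eq_bigr do rewrite !mxE.
  have := congr1 DE (Clt j); rewrite -[DE (iter _ _ _)]/(iter j.+1 DE y).
  rewrite Cle // derivation_sum //; under [in RHS]eq_bigr do rewrite DEP.2.
  rewrite big_split /= => e.
  apply: (addIr (\sum_i C 0 i * DE (iter j DE (b i)))); rewrite add0r.
  exact: esym e.
have C_cst i : exists x, C 0 i = c x.
  apply: cst; move/(congr1 (mulmx^~ (invmx U))): DC.
  by rewrite mulmxK // mul0mx => /rowP/(_ i); rewrite !mxE.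
have [a ea] := fin_all_exists C_cst; exists a; rewrite -[y]/(iter 0 DE y) Cle //.
by apply: eq_bigr => i _; rewrite ea.
Qed.

(** * Telescopers *)

Section Telescopers.

Variables (F : fieldType) (E : closedFieldType) (iota : {rmorphism F -> E}).
Variables (D : F -> F) (DE : E -> E).
Hypothesis char0 : [pchar F] =i pred0.
Hypothesis iota_alg : is_algebraic_closure iota.
Hypotheses (DP : is_derivation D) (DEP : is_derivation DE).
Hypothesis DEiota : forall e, DE (iota e) = iota (D e).

Local Notation "p ^i" := (map_poly iota p) (at level 2, format "p ^i").
Local Notation act_t := (diffop_act (@ratC F) (frac_der (map_poly D))).
Local Notation act_E := (diffop_act iota DE).

Lemma telescoper_solution L (u : ratfun F) :
  ~ exact u -> exact (act_t L u) -> exists y : E, y != 0 /\ act_E L y = 0.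
Proof.
move=> nu Lu; have [a [b [sb eu]]] := hermite_reduction char0 iota_alg u.
have [v [w Db]] := separable_der_eq D sb.
have Lres := (exact_act_residues char0 DP DEP DEiota sb Db L eu).1 Lu.
apply: NNPP => noy; apply/nu/(exact_residues iota char0 sb eu) => z bz.
apply: NNPP => /eqP yz; apply: noy; exists (residue iota b a z).
by split; last exact: Lres.
Qed.

(* With p the minimal polynomial of y, the residues of x p' / p are the
   conjugates of y, and L annihilates all of them if it annihilates y. *)
Lemma solution_telescoper L (y : E) : y != 0 -> act_E L y = 0 ->
  exists u : ratfun F, ~ exact u /\ exact (act_t L u).
Proof.
move=> y0 Ly; have [p [p0 py minp]] := minimal_polynomial (iota_alg y).
have sp := irreducible_separable char0 (minimal_irreducible p0 py minp).
have [v [w Dp]] := separable_der_eq D sp.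
pose a := 'X * p^`(); have resE z : root p^i z -> residue iota p a z = z.
  move=> pz; rewrite /residue /a rmorphM /= map_polyX -deriv_map hornerM hornerX.
  by rewrite mulfK // (separable_root_deriv sp).
have e0 : exact (tofrac a / tofrac p - tofrac a / tofrac p).
  by rewrite subrr; apply: exact0.
exists (tofrac a / tofrac p); split.
  move/(exact_residues iota char0 sp e0)/(_ y py); rewrite resE // => /eqP.
  by rewrite (negPf y0).
apply/(exact_act_residues char0 DP DEP DEiota sp Dp L e0) => z pz.
apply/eqP; rewrite (residue_reduced_act DP DEP DEiota sp Dp) //.
rewrite residue_eq0 //.
(* The residue of this numerator at [y] is L(y) = 0, and minimality of [p] spreads the zero to all
   conjugates. *)
have : p %| reduced_act D v w L a.
  apply: minp; rewrite -(residue_eq0 sp) //.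
  by rewrite -(residue_reduced_act DP DEP DEiota sp Dp) // resE // Ly.
by rewrite -(dvdp_map iota) => /root_dvdp; apply.
Qed.

(* A minimal annihilator of u of order n makes the first n reduced derivatives
   of a linearly independent modulo b over F, hence over E, where b splits: the
   vectors of the iterated derivatives of the residues have rank n. *)
Lemma minimal_fundamental_system n L (u : ratfun F) :
  exact (act_t L u) ->
  (forall M : {poly F}, (size M <= n)%N -> exact (act_t M u) -> M = 0) ->
  exists r : 'I_n -> E, (forall i, act_E L (r i) = 0) /\
    \matrix_(i < n, j < n) iter j DE (r i) \in unitmx.
Proof.
move=> Lu minL; have [a [b [sb eu]]] := hermite_reduction char0 iota_alg u.
have b0 := separable_poly_neq0 sb.
have [v [w Db]] := separable_der_eq D sb.
have Lres := (exact_act_residues char0 DP DEP DEiota sb Db L eu).1 Lu.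
(* Reduction modulo [b] preserves values at the roots of [b] and bounds the size, so each [A j] fits
   in a row of [G]. *)
pose A j := iter j (reduced_der D v w) a %% b.
have A_root j z : root b^i z ->
    (A j)^i.[z] = (iter j (reduced_der D v w) a)^i.[z].
  move=> bz; rewrite [in RHS](divp_eq (iter _ _ _) b) rmorphD rmorphM /=.
  by rewrite hornerD hornerM (rootP bz) mulr0 add0r.
pose G := \matrix_(j < n, l < size b) (A j)`_l.
have freeG : row_free G.
  apply: inj_row_free => c cG.
  have sumA : \sum_(j < n) c 0 j *: A j = 0.
    apply/polyP=> l; rewrite coef0; have [lb|bl] := ltnP l (size b).
      have /rowP/(_ (Ordinal lb)) := cG; rewrite !mxE => e.
      by rewrite coef_sum -[RHS]e; apply: eq_bigr => j _; rewrite coefZ mxE.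
    rewrite coef_sum big1 // => j _; rewrite coefZ nth_default ?mulr0 //.
    by apply: leq_trans bl; rewrite ltnW // ltn_modp.
  (* A linear relation among the [A j] is read as an operator killing every residue of [u];
     minimality makes it zero. *)
  pose M := \poly_(j < n) oapp (c 0) 0 (insub j).
  have cM (j : 'I_n) : M`_j = c 0 j by rewrite coef_poly ltn_ord valK.
  have M0 : M = 0.
    apply: minL; first exact: size_poly.
    apply/(exact_act_residues char0 DP DEP DEiota sb Db M eu) => z bz.
    rewrite (diffop_act_widen _ _ _ (size_poly _ _)).
    under eq_bigr => j _.
      rewrite cM (residue_iter DP DEP DEiota sb Db) // /residue -A_root //.
      rewrite mulrA -hornerZ; over.
    rewrite -mulr_suml -horner_sum.
    under eq_bigr do rewrite -map_polyZ.
    by rewrite -rmorph_sum sumA rmorph0 horner0 mul0r.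
  by apply/rowP=> j; rewrite -cM M0 coef0 mxE.
have [rs ers] := closed_field_poly_normal b^i.
have rsP z : root b^i z = (z \in rs).
  by rewrite ers rootZ ?root_prod_XsubC // lead_coef_eq0 map_poly_eq0.
pose W := \matrix_(i < size rs, j < n) iter j DE (residue iota b a rs`_i).
(* A relation over [E] among the columns of [W] yields a combination [Q] of the [A j] vanishing at
   all roots of [b]. As [Q] is smaller than the separable [b], it is zero, and freeness of [G]
   survives the extension to [E]. *)
have fullW : row_full W.
  rewrite /row_full -mxrank_tr -[_ == _]/(row_free W^T).
  apply: inj_row_free => c cW; apply/eqP.
  rewrite -(mulmx_free_eq0 c (B := map_mx iota G)) ?row_free_map //.
  pose Q := \sum_(j < n) c 0 j *: (A j)^i.
  have Q0 : Q = 0.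
    apply/eqP; apply/negP=> /negP Q0.
    have : b^i %| Q.
      apply: (separable_dvdp (iota := idfun)); first by rewrite separable_map.
      move=> z; rewrite !map_poly_id // => bz.
      have zi : (index z rs < size rs)%N by rewrite index_mem -rsP.
      have /rowP/(_ (Ordinal zi)) := cW; rewrite !mxE /= => e.
      rewrite /root horner_sum; apply/eqP.
      apply: (mulIf (invr_neq0 (separable_root_deriv (iota := iota) sb bz))).
      rewrite mul0r mulr_suml -[RHS]e.
      apply: eq_bigr => j _; rewrite !mxE nth_index -?rsP //.
      rewrite (residue_iter DP DEP DEiota sb Db) // hornerZ A_root //.
      by rewrite mulrA.
    move/(dvdp_leq Q0); apply/negP; rewrite -ltnNge size_map_poly.
    apply: (big_ind (fun q : {poly E} => size q < size b)%N) => [|p q sp sq|j _].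
    - by rewrite size_poly0 size_poly_gt0.
    - by apply: leq_ltn_trans (size_polyD _ _) _; rewrite gtn_max sp.
    by apply: leq_ltn_trans (size_scale_leq _ _) _; rewrite size_map_poly ltn_modp.
  apply/eqP/rowP=> l; rewrite !mxE.
  transitivity Q`_l; last by rewrite Q0 coef0.
  by rewrite /Q coef_sum; apply: eq_bigr => j _; rewrite !mxE coefZ coef_map.
(* Full column rank allows [n] independent rows, that is [n] residues, to be selected. *)
exists (fun i => residue iota b a rs`_(fullrankfun fullW i)); split=> [i|].
  by apply: Lres; rewrite rsP mem_nth.
rewrite -[X in X \in _](_ : rowsub (fullrankfun fullW) W = _).
  exact: fullrowsub_unit.
by apply/matrixP=> i j; rewrite !mxE.
Qed.

End Telescopers.

Theorem theorem4p16 (k : closedFieldType) (char0 : [pchar k] =i pred0)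
    (Kbar : closedFieldType) (iota : {rmorphism ratfun k -> Kbar})
    (Kbar_closure : is_algebraic_closure iota)
    (Dbar : Kbar -> Kbar) (Dbar_derivation : is_derivation Dbar)
    (Dbar_extends : forall e : ratfun k, Dbar (iota e) = iota (Dt0 e))
    (L : {poly ratfun k}) (L_neq0 : L != 0) :
  ((exists f : biratfun k,
      ~ Dx_exact f /\ Dx_exact (diffop_act (@ratC (ratfun k)) (@Dt k) L f)) <->
   (exists y : Kbar, y != 0 /\ diffop_act iota Dbar L y = 0)) /\
  ((exists f : biratfun k, is_minimal_telescoper f L) ->
   has_dimension (fun c : k => iota (ratC c))
     (fun y : Kbar => diffop_act iota Dbar L y = 0) (size L).-1).
Proof.
have charK : [pchar ratfun k] =i pred0.
  by move=> n; rewrite (fmorph_pchar (@ratC k)).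
have DP := @Dt0_derivation k; split; first split.
- case=> f [nf Lf]; exact: (telescoper_solution charK Kbar_closure DP
    Dbar_derivation Dbar_extends nf Lf).
- case=> y [y0 Ly]; exact: (solution_telescoper charK Kbar_closure DP
    Dbar_derivation Dbar_extends y0 Ly).
case=> f [mL minL]; set n := (size L).-1.
have sL : size L = n.+1 by rewrite prednK // size_poly_gt0.
have Lf : exact (diffop_act (@ratC (ratfun k)) (@Dt k) L f).
  (* [L] is its own multiple by the operator 1, hence a telescoper of [f]. *)
  have /minL[/eqP|[] //] : exists A, L = diffop_mul (@Dt0 k) A L.
    by exists 1; rewrite /diffop_mul size_poly1 big_ord1 coef1 scale1r.
  by rewrite (negPf L_neq0).
have [|r [Lr Ur]] := minimal_fundamental_system (n := n) charK Kbar_closure DP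
    Dbar_derivation Dbar_extends Lf.
  (* A nonzero telescoper is a left multiple of [L], so its size is at least [n.+1]. *)
  move=> M sM Mf; apply: NNPP => /eqP M0.
  have /minL[A eM] : M = 0 \/ is_telescoper f M by right.
  have A0 : A != 0.
    by apply: contraNneq M0 => A0; rewrite eM A0 /diffop_mul size_poly0 big_ord0.
  by have := size_diffop_mul (@Dt0 k) mL A0; rewrite -eM sL ltnNge sM.
apply: (@wronskian_basis k (ratfun k) Kbar (iota \o @ratC k)) Ur => //.
  by move=> a /=; rewrite Dbar_extends Dt0C rmorph0.
move=> u; apply: (algebraic_constants (c := @ratC k) DP) => // e.
exact: ratfun_constants.
Qed.
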